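(* Let $X$ be an $\mathbb{R}^d$-valued random vector and let $W$ be an $\mathbb{R}^d$-valued log-concave random vector with radially-symmetric density, independent of $X$. Then for any contraction $T:\mathbb{R}^d\to\mathbb{R}^d$ and any $t>0$, $$D_2^t(T(X)+W)\le D_2^t(X+W).$$ Consequently, $h_2(T(X)+W)\le h_2(X+W)$.
   Context: A contraction is a $1$-Lipschitz map for the Euclidean norm $\|\cdot\|$. A random vector is log-concave if it has a density of the form $e^{-\phi}$ with $\phi:\mathbb{R}^d\to(-\infty,\infty]$ convex. For a random vector $Y$ in $\mathbb{R}^d$ with density $f$, $h_2(Y)=-\log\int_{\mathbb{R}^d}f^2$. Diversity of order $2$ at scaling $t>0$: for a random vector $Y$ in $\mathbb{R}^d$ with distribution $\mu$, $$D_2^t(Y)=D_2^t(\mu)=\left(\int_{\mathbb{R}^d}K^t\mu\,d\mu\right)^{-1},\qquad K^t\mu(x)=\int_{\mathbb{R}^d}e^{-t\|x-y\|}\,d\mu(y).$$ *)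

(* Defs.v *)
From HB Require Import structures.
From mathcomp Require Import all_boot all_order all_algebra.
From mathcomp Require Import all_classical all_reals all_analysis.

Set Implicit Arguments.
Unset Strict Implicit.
Unset Printing Implicit Defensive.

Import Order.TTheory GRing.Theory Num.Theory.
Import numFieldNormedType.Exports.

Local Open Scope classical_set_scope.
Local Open Scope ring_scope.

Definition measure_rV_display : measure_display -> measure_display.
Proof. exact. Qed.

(* The sigma-algebra on row vectors is the one generated by the coordinates; on
   'rV[R]_n with R : realType it is the Borel sigma-algebra. *)
Section measurable_rV.
Context {disp} {T : sigmaRingType disp}.
Variable n : nat.

Definition coord_rV (i : 'I_n) (v : 'rV[T]_n) : T := v ord0 i.

Let rV_set0 : g_sigma_preimage coord_rV set0.
Proof. exact: sigma_algebra0. Qed.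

Let rV_setC A : g_sigma_preimage coord_rV A -> g_sigma_preimage coord_rV (~` A).
Proof. exact: sigma_algebraC. Qed.

Let rV_bigcup (F : _^nat) : (forall i, g_sigma_preimage coord_rV (F i)) ->
  g_sigma_preimage coord_rV (\bigcup_i (F i)).
Proof. exact: sigma_algebra_bigcup. Qed.

HB.instance Definition _ := @isMeasurable.Build (measure_rV_display disp)
  'rV[T]_n (g_sigma_preimage coord_rV) rV_set0 rV_setC rV_bigcup.

End measurable_rV.

Lemma measurable_coord_rV disp (T : sigmaRingType disp) n (i : 'I_n) :
  measurable_fun setT (@coord_rV disp T n i).
Proof.
move=> _ Y mY; rewrite setTI; apply: sub_sigma_algebra => /=.
rewrite -bigcup_seq/=; exists i => /=; first by rewrite mem_index_enum.
by exists Y => //; rewrite setTI.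
Qed.

Lemma measurable_fun_rVP disp1 disp2 (T1 : measurableType disp1)
    (T2 : measurableType disp2) n (f : T1 -> 'rV[T2]_n) :
  measurable_fun setT f <->
  forall i, measurable_fun setT (fun x => f x ord0 i).
Proof.
split=> [mf i|mf].
  exact: (measurableT_comp (@measurable_coord_rV _ T2 n i) mf).
have : preimage_set_system setT f
    (g_sigma_preimage (@coord_rV _ T2 n)) `<=` measurable.
  rewrite -g_sigma_preimage_comp; apply: smallest_sub.
    exact: sigma_algebra_measurable.
  rewrite -bigcup_seq; apply: bigcup_sub => i _ A [B mB <-].
  exact: mf.
by move=> sub _ A mA; apply: sub; exists A.
Qed.

Section rV_cons.
Context {R : realType}.
Variable n : nat.

Definition rV_cons (p : R * 'rV[R]_n) : 'rV[R]_n.+1 :=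
  row_mx (p.1%:M : 'rV_1) p.2.

Definition rV_uncons (v : 'rV[R]_n.+1) : R * 'rV[R]_n :=
  (v ord0 ord0, \row_(i < n) v ord0 (lift ord0 i)).

Lemma rV_cons0 p : rV_cons p ord0 ord0 = p.1.
Proof.
rewrite /rV_cons mxE; case: splitP => [j _|k]; last by rewrite /= add1n.
by rewrite mxE !ord1 eqxx mulr1n.
Qed.

Lemma rV_consS p (i : 'I_n) : rV_cons p ord0 (lift ord0 i) = p.2 ord0 i.
Proof.
rewrite /rV_cons mxE; case: splitP => [j|k /= /eqP].
  by rewrite !ord1.
by rewrite /bump leq0n add1n eqSS => /eqP/val_inj ->.
Qed.

Lemma rV_consK : cancel rV_cons rV_uncons.
Proof.
move=> [x v]; rewrite /rV_uncons rV_cons0; congr (_, _).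
by apply/rowP => i; rewrite mxE rV_consS.
Qed.

Lemma rV_unconsK : cancel rV_uncons rV_cons.
Proof.
move=> v; apply/rowP => i; case: (unliftP ord0 i) => [j|] ->.
  by rewrite rV_consS mxE.
by rewrite rV_cons0.
Qed.

Lemma measurable_rV_cons : measurable_fun setT rV_cons.
Proof.
apply/measurable_fun_rVP => i; case: (unliftP ord0 i) => [j|] ->.
  under eq_fun do rewrite rV_consS.
  exact: (measurableT_comp (@measurable_coord_rV _ R n j) measurable_snd).
by under eq_fun do rewrite rV_cons0; exact: measurable_fst.
Qed.

Lemma measurable_rV_uncons : measurable_fun setT rV_uncons.
Proof.
apply/measurable_fun_pairP; split => /=.
  exact: (@measurable_coord_rV _ R n.+1 ord0).
apply/measurable_fun_rVP => i /=; under eq_fun do rewrite mxE.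
exact: (@measurable_coord_rV _ R n.+1 (lift ord0 i)).
Qed.

End rV_cons.

Section lebesgue_rV_step.
Context {R : realType}.
Variables (n : nat) (m : {sigma_finite_measure set 'rV[R]_n -> \bar R}).
Local Open Scope ereal_scope.

Definition lebesgue_rV_step : set 'rV[R]_n.+1 -> \bar R :=
  pushforward (@lebesgue_measure R \x m) (@rV_cons R n).

Let step0 : lebesgue_rV_step set0 = 0.
Proof. by rewrite /lebesgue_rV_step /pushforward preimage_set0 measure0. Qed.

Let step_ge0 A : 0 <= lebesgue_rV_step A.
Proof. by rewrite /lebesgue_rV_step /pushforward; exact: measure_ge0. Qed.

Let step_sigma_additive : semi_sigma_additive lebesgue_rV_step.
Proof.
have mc (A : set 'rV[R]_n.+1) :
    measurable A -> measurable (@rV_cons R n @^-1` A).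
  by move=> mA; rewrite -[X in measurable X]setTI; exact: measurable_rV_cons.
move=> F mF tF mUF; rewrite /lebesgue_rV_step /pushforward preimage_bigcup.
apply: measure_semi_sigma_additive.
- by move=> k; exact: mc.
- apply/trivIsetP => /= i j _ _ ij; rewrite -preimage_setI.
  by move/trivIsetP : tF => /(_ _ _ _ _ ij) ->//; rewrite preimage_set0.
- by rewrite -preimage_bigcup; exact: mc.
Qed.

HB.instance Definition _ :=
  isMeasure.Build _ _ _ lebesgue_rV_step step0 step_ge0 step_sigma_additive.

Let step_sigma_finite : sigma_finite setT lebesgue_rV_step.
Proof.
have /sigma_finiteP[F [TF ndF Foo]] := sigma_finiteT (@lebesgue_measure R).
have /sigma_finiteP[G [TG ndG Goo]] := sigma_finiteT m.
exists (fun k => @rV_uncons R n @^-1` (F k `*` G k)).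
  rewrite -preimage_bigcup (_ : \bigcup_i _ = setT) ?preimage_setT//.
  apply/seteqP; split => // -[x y] _.
  have [i _ Fx] : (\bigcup_i F i) x by rewrite -TF.
  have [j _ Gy] : (\bigcup_i G i) y by rewrite -TG.
  exists (maxn i j) => //; split => /=.
    by move: x Fx; exact/subsetPset/ndF/leq_maxl.
  by move: y Gy; exact/subsetPset/ndG/leq_maxr.
move=> k; have [mF Fk] := Foo k; have [mG Gk] := Goo k; split.
  rewrite -[X in measurable X]setTI; apply: measurable_rV_uncons => //.
  exact: measurableX.
rewrite /lebesgue_rV_step /pushforward -comp_preimage (_ : _ \o _ = id).
  by rewrite preimage_id product_measure1E// lte_mul_pinfty// ge0_fin_numE.
by apply/funext => p /=; rewrite rV_consK.
Qed.

HB.instance Definition _ :=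
  Measure_isSigmaFinite.Build _ _ _ lebesgue_rV_step step_sigma_finite.

End lebesgue_rV_step.

(* Lebesgue measure on R^n, as the n-fold product of the one on R. *)
Fixpoint lebesgue_rV {R : realType} (n : nat) :
    {sigma_finite_measure set 'rV[R]_n -> \bar R} :=
  match n with
  | 0 => @dirac _ 'rV[R]_0 0 R
  | n.+1 => lebesgue_rV_step (lebesgue_rV n)
  end.

Lemma lebesgue_rV_box (R : realType) (n : nat) (A : 'I_n -> set R) :
  (forall i, measurable (A i)) ->
  lebesgue_rV n [set v : 'rV[R]_n | forall i, A i (v ord0 i)] =
  (\prod_(i < n) @lebesgue_measure R (A i))%E.
Proof.
elim: n A => [|n IHn] A mA.
  by rewrite big_ord0 /= diracE mem_set// => -[].
rewrite big_ord_recl -IHn//= /lebesgue_rV_step /pushforward.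
have mB : measurable [set v : 'rV[R]_n | forall i, A (lift ord0 i) (v ord0 i)].
  rewrite (_ : [set _ | _] = \bigcap_(i in [set: 'I_n])
      ((@coord_rV _ R n i) @^-1` A (lift ord0 i))).
    apply: fin_bigcap_measurable => // i _.
    by rewrite -[X in measurable X]setTI; exact: measurable_coord_rV.
  by apply/seteqP; split => v /= h i => [_|]; exact: h.
rewrite -product_measure1E//=; last exact: mA.
congr (product_measure1 _ _ _); apply/seteqP; split => [[x v]|[x v] []] /=.
  move=> h; split; first by have := h ord0; rewrite rV_cons0.
  by move=> i; have := h (lift ord0 i); rewrite rV_consS.
move=> hx hv i; case: (unliftP ord0 i) => [j|] ->.
  by rewrite rV_consS; exact: hv.
by rewrite rV_cons0.
Qed.

Section euclidean.
Context {R : realType} {d : nat}.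
Implicit Types (x y : 'rV[R]_d).

(* The library's `|x| on 'rV[R]_d is the sup norm. *)
Definition enorm x : R := Num.sqrt (\sum_(i < d) x ord0 i ^+ 2).

Definition euclidean_contraction (T : 'rV[R]_d -> 'rV[R]_d) : Prop :=
  forall x y, enorm (T x - T y) <= enorm (x - y).

Definition radially_symmetric (f : 'rV[R]_d -> R) : Prop :=
  forall x y, enorm x = enorm y -> f x = f y.

Definition econvex (phi : 'rV[R]_d -> \bar R) : Prop :=
  forall x y (l : R), 0 <= l <= 1 ->
    (phi (l *: x + (1 - l) *: y)%R <= l%:E * phi x + (1 - l)%:E * phi y)%E.

Definition log_concave (f : 'rV[R]_d -> R) : Prop :=
  exists phi : 'rV[R]_d -> \bar R,
    [/\ forall x, phi x != -oo%E, econvex phi &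
        forall x, (f x)%:E = expeR (- phi x)].

End euclidean.

Section law_functionals.
Context {R : realType} {d : nat}.
Implicit Types (mu : set 'rV[R]_d -> \bar R) (f : 'rV[R]_d -> R).

Definition has_density mu f : Prop :=
  [/\ measurable_fun setT f, forall x, 0 <= f x &
      forall A, measurable A ->
        mu A = (\int[lebesgue_rV d]_(x in A) (f x)%:E)%E].

Definition kernel_avg (t : R) mu (x : 'rV[R]_d) : \bar R :=
  (\int[mu]_y (expR (- (t * enorm (x - y))))%:E)%E.

(* For a probability mu the double integral is a real in ]0, 1]. *)
Definition diversity2 (t : R) mu : R :=
  (fine (\int[mu]_x kernel_avg t mu x)%E)^-1.

(* All densities of mu agree almost everywhere, so the set below has at most one
   element; h_2 is set to -oo when mu has no density. *)
Definition renyi2 mu : \bar R :=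
  xget -oo%E [set h | exists2 f, has_density mu f &
    h = (- lne (\int[lebesgue_rV d]_x ((f x) ^+ 2)%:E))%E].

End law_functionals.

Definition independent_rv disp (Omega : measurableType disp) (R : realType)
    (P : probability Omega R) disp1 (T1 : measurableType disp1)
    disp2 (T2 : measurableType disp2) (X : Omega -> T1) (Y : Omega -> T2) : Prop :=
  forall A B, measurable A -> measurable B ->
    P (X @^-1` A `&` Y @^-1` B) = (P (X @^-1` A) * P (Y @^-1` B))%E.

(* Main.v *)
(* Two independent copies of T(X) + W have difference T(X) - T(X') + (W - W'), so
   both functionals have the form E G(T(X) - T(X')), where G is obtained from a
   radially decreasing function (the exponential kernel for the diversity, the
   density of W for h_2) by convolving with the law of W. A log-concave radially
   symmetric density is radially decreasing, and convolution preserves radial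
   monotonicity; hence G(T(x) - T(x')) >= G(x - x') because T is a contraction. *)
Require Import Defs.
From HB Require Import structures.
From mathcomp Require Import all_boot all_order all_algebra.
From mathcomp Require Import all_classical all_reals all_analysis.
From mathcomp Require Import measurable_realfun ring lra.

Import Order.TTheory GRing.Theory Num.Theory.
Import numFieldNormedType.Exports.

Local Open Scope classical_set_scope.
Local Open Scope ring_scope.

Set Implicit Arguments.
Unset Strict Implicit.
Unset Printing Implicit Defensive.

(** For the diversity both noises W and W' remain to be averaged, so G is the exponential kernel
    convolved twice with the density [f] of W. For h_2 one noise is already spent on the density E
    f(y - Z) of Z + W, so G is [f] convolved once with itself. Radial symmetry makes [f] even, so W
    - W' may be treated as a sum. The analytic core is that convolution preserves radial
    monotonicity. The proof compares the integrand at w and at its mirror image in the hyperplane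
    bisecting z and z', which requires Lebesgue measure to be invariant under reflections in
    arbitrary hyperplanes. The measure is an iterated product along the coordinate axes, so only
    translations can be handled coordinate by coordinate; reflections are then deduced from
    translations. Integrands are nonnegative with values in [\bar R], so Tonelli applies throughout,
    and finiteness of an integral is checked only where [fine] is taken. *)

Definition pushforward_measure {d1 d2} {T1 : measurableType d1}
    {T2 : measurableType d2} {R : realType} (m : {measure set T1 -> \bar R})
    {f : T1 -> T2} (mf : measurable_fun setT f) : {measure set T2 -> \bar R} :=
  measure_function_pushforward__canonical__measure_function_Measure m mf.

Lemma measurable_preimage {d1 d2} {T1 : measurableType d1} {T2 : measurableType d2}
    {f : T1 -> T2} (A : set T2) :
  measurable_fun setT f -> measurable A -> measurable (f @^-1` A).
Proof. by move=> mf mA; rewrite -[X in measurable X]setTI; exact: mf. Qed.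

(** The translated measure agrees with Lebesgue measure on half-open intervals, which determine
    it. *)
Lemma lebesgue_measure_translation (R : realType) (c : R) (A : set R) :
  measurable A ->
  lebesgue_measure ((fun x : R => x + c) @^-1` A) = lebesgue_measure A.
Proof.
move=> mA.
have mshift : measurable_fun setT
    (fun x : measurableTypeR R => x + c : measurableTypeR R).
  exact: measurable_funD.
have := @lebesgue_measure_unique R (pushforward_measure lebesgue_measure mshift).
move=> /(_ _ A mA) -> // _ [[a b] /= _ <-].
rewrite /= /pushforward /=.
rewrite (_ : _ @^-1` _ = `]a - c, b - c]%classic); last first.
  apply/seteqP; split => x /=; rewrite !in_itv /= => /andP[h1 h2];
    apply/andP; split; lra.
rewrite !lebesgue_measure_itv /= !lte_fin ltrD2r -!EFinD.
by case: ifP => // _; congr EFin; ring.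
Qed.

(** * Measurability of vector operations and of the Euclidean norm *)

Section vector_measurability.
Context {R : realType} {disp : measure_display} {S : measurableType disp}.
Variable d : nat.
Implicit Types f g : S -> 'rV[R]_d.

Lemma measurable_rVD f g : measurable_fun setT f -> measurable_fun setT g ->
  measurable_fun setT (fun x => f x + g x).
Proof.
move=> /measurable_fun_rVP mf /measurable_fun_rVP mg; apply/measurable_fun_rVP => i.
by under eq_fun do rewrite mxE; apply: measurable_funD.
Qed.

Lemma measurable_rVZ (c : S -> R) f : measurable_fun setT c -> measurable_fun setT f ->
  measurable_fun setT (fun x => c x *: f x).
Proof.
move=> mc /measurable_fun_rVP mf; apply/measurable_fun_rVP => i.
by under eq_fun do rewrite mxE; apply: measurable_funM.
Qed.

Lemma measurable_rVN f : measurable_fun setT f -> measurable_fun setT (fun x => - f x).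
Proof.
by move=> mf; under eq_fun do rewrite -scaleN1r; apply: measurable_rVZ.
Qed.

Lemma measurable_rVB f g : measurable_fun setT f -> measurable_fun setT g ->
  measurable_fun setT (fun x => f x - g x).
Proof. by move=> mf mg; apply: measurable_rVD => //; exact: measurable_rVN. Qed.

Lemma measurable_enorm f : measurable_fun setT f ->
  measurable_fun setT (fun x => enorm (f x)).
Proof.
move=> /measurable_fun_rVP mf; 
apply: (measurableT_comp (continuous_measurable_fun (@sqrt_continuous R))).
by apply: measurable_sum => i; exact: measurable_funX.
Qed.

End vector_measurability.

(** * Euclidean inner product and norm *)

Section enorm_theory.
Context {R : realType} {d : nat}.
Implicit Types x y u : 'rV[R]_d.

Definition edot x y : R := \sum_(i < d) x ord0 i * y ord0 i.

Lemma edotDl x y u : edot (x + y) u = edot x u + edot y u.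
Proof. by rewrite -big_split; apply: eq_bigr => i _; rewrite mxE mulrDl. Qed.

Lemma edotZl (a : R) x u : edot (a *: x) u = a * edot x u.
Proof. by rewrite mulr_sumr; apply: eq_bigr => i _; rewrite mxE mulrA. Qed.

Lemma edotC x y : edot x y = edot y x.
Proof. by apply: eq_bigr => i _; rewrite mulrC. Qed.

Lemma edotNl x u : edot (- x) u = - edot x u.
Proof. by rewrite -scaleN1r edotZl mulN1r. Qed.

Lemma edotDr x y u : edot u (x + y) = edot u x + edot u y.
Proof. by rewrite edotC edotDl !(edotC u). Qed.

Lemma edotNr x u : edot u (- x) = - edot u x.
Proof. by rewrite edotC edotNl (edotC u). Qed.

Lemma edotZr (a : R) x u : edot u (a *: x) = a * edot u x.
Proof. by rewrite edotC edotZl (edotC u). Qed.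

Lemma edot_ge0 x : 0 <= edot x x.
Proof. by apply: sumr_ge0 => i _; rewrite -expr2 sqr_ge0. Qed.

Lemma edot_gt0 x : x != 0 -> 0 < edot x x.
Proof.
move=> x0; rewrite lt_neqAle edot_ge0 andbT eq_sym; apply: contra x0.
rewrite psumr_eq0 => [/allP h|i _]; last by rewrite -expr2 sqr_ge0.
apply/eqP/rowP => i; rewrite mxE; apply/eqP.
by have := h i (mem_index_enum i); rewrite /= -expr2 sqrf_eq0.
Qed.

Lemma enormE x : enorm x = Num.sqrt (edot x x).
Proof. by congr Num.sqrt; apply: eq_bigr => i _; rewrite expr2. Qed.

Lemma enorm_ge0 x : 0 <= enorm x. Proof. exact: sqrtr_ge0. Qed.

Lemma ler_enorm x y : (enorm x <= enorm y) = (edot x x <= edot y y).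
Proof. by rewrite !enormE ler_sqrt ?edot_ge0. Qed.

Lemma enormN x : enorm (- x) = enorm x.
Proof. by rewrite !enormE edotNl edotNr opprK. Qed.

Lemma enormZ (a : R) x : enorm (a *: x) = `|a| * enorm x.
Proof. by rewrite !enormE edotZl edotZr mulrA -expr2 sqrtrM ?sqr_ge0// sqrtr_sqr. Qed.

Lemma coord_le_enorm x i : `|x ord0 i| <= enorm x.
Proof.
rewrite -sqrtr_sqr enormE ler_sqrt ?edot_ge0// /edot (bigD1 i)//= expr2 lerDl.
by apply: sumr_ge0 => j _; rewrite -expr2 sqr_ge0.
Qed.

(** A crude substitute for e / sqrt d that avoids roots and also makes sense for d = 0. *)
Lemma enorm_le_coord x (e : R) :
  (forall i, `|x ord0 i| <= e / d.+1%:R) -> 0 <= e -> enorm x <= e.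
Proof.
move=> h e0; rewrite -(ger0_norm e0) -sqrtr_sqr enormE ler_sqrt ?sqr_ge0//.
(* Cut e^2 into d + 1 equal parts: d of them dominate the squared coordinates, as (e / (d + 1))^2 <=
   e^2 / (d + 1), and the last one is dropped. *)
have -> : e ^+ 2 = \sum_(i < d.+1) (e ^+ 2 / d.+1%:R).
  by rewrite sumr_const card_ord -[RHS]mulr_natr mulfVK// pnatr_eq0.
rewrite big_ord_recr /= -[leLHS]addr0 lerD//; last by rewrite divr_ge0// sqr_ge0.
apply: ler_sum => i _; rewrite -expr2 -real_normK ?num_real//.
rewrite (le_trans (lerXn2r _ _ _ (h i)))// ?nnegrE ?divr_ge0//.
rewrite expr2 mulrACA -expr2 ler_wpM2l ?sqr_ge0// ler_piMl// ?invr_ge0//.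
by rewrite invf_le1// ler1n.
Qed.

End enorm_theory.

(** Each coordinate [g] of [T] is 1-Lipschitz, so the set where g < a is a countable union of balls
    with rational centres q and radii a - g q. This works directly with the sigma-algebra generated
    by the coordinates. *)
Lemma measurable_euclidean_contraction (R : realType) (d : nat)
    (T : 'rV[R]_d -> 'rV[R]_d) : euclidean_contraction T -> measurable_fun setT T.
Proof.
move=> cT; apply/measurable_fun_rVP => i; set g := fun x => _.
have gl x y : g x - g y <= enorm (x - y).
  apply: le_trans (cT x y); apply: le_trans (coord_le_enorm _ i).
  by rewrite !mxE ler_norm.
apply: (measurability _ (RGenInftyO.measurableE R)) => //.
move=> /= _ [_ [a ->] <-]; rewrite setTI.
rewrite (_ : _ @^-1` _ = \bigcup_(q : 'rV[rat]_d)
    [set x | enorm (x - map_mx ratr q) < a - g (map_mx ratr q)]); last first.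
  apply/seteqP; split => [x|x [q _]] /=; rewrite in_itv /= => xa.
    (* For q within e of x, the Lipschitz bound gives a - g q >= 2 e > e, so x lies in the open ball
       around q. *)
    pose e := (a - g x) / 3; have e0 : 0 < e by rewrite divr_gt0// subr_gt0.
    pose e' := e / d.+1%:R; have e'0 : 0 < e' by rewrite divr_gt0.
    have hq j : exists q : rat, `|x ord0 j - ratr q| <= e'.
      have [q] := @rat_in_itvoo R (x ord0 j - e') (x ord0 j) ltac:(lra).
      by rewrite in_itv /= => /andP[h1 h2]; exists q; rewrite ger0_norm; lra.
    pose q := \row_j projT1 (cid (hq j)).
    have xq : enorm (x - map_mx ratr q) <= e.
      apply: enorm_le_coord (ltW e0) => j; rewrite !mxE; exact: (projT2 (cid (hq j))).
    exists q => //=; have := gl (map_mx ratr q) x.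
    by rewrite -enormN opprB; move: xq; rewrite /e; lra.
  by have := gl x (map_mx ratr q); lra.
apply: countable_bigcupT_measurable => // q.
have mq : measurable_fun setT (fun x : 'rV[R]_d => enorm (x - map_mx ratr q)).
  by apply: measurable_enorm; exact: measurable_rVB.
rewrite (_ : [set x | _] =
    (fun x => enorm (x - map_mx ratr q)) @^-1` `]-oo, a - g (map_mx ratr q)[%classic).
  exact: (measurable_preimage mq).
by apply/seteqP; split => x /=; rewrite in_itv.
Qed.

(** * Translation invariance of Lebesgue measure on row vectors *)

Lemma rV_consD (R : realType) n (p q : R * 'rV[R]_n) :
  rV_cons p + rV_cons q = rV_cons (p.1 + q.1, p.2 + q.2).
Proof.
apply/rowP => i; rewrite [LHS]mxE; case: (unliftP ord0 i) => [j|] ->.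
  by rewrite !rV_consS [RHS]mxE.
by rewrite !rV_cons0.
Qed.

Section lebesgue_rV_invariance.
Context {R : realType}.

(** By induction on the dimension: a translation acts separately on the first coordinate and on the
    others, so it preserves the measure of rectangles, and these determine a product of sigma-finite
    measures. *)
Lemma lebesgue_rV_translation (d : nat) (c : 'rV[R]_d) (A : set 'rV[R]_d) :
  measurable A -> lebesgue_rV d ((fun x => x + c) @^-1` A) = lebesgue_rV d A.
Proof.
elim: d c A => [|n IHn] c A mA.
  congr (lebesgue_rV 0 _).
  by apply/seteqP; split => x /=; rewrite [x + c]thinmx0 [x]thinmx0.
rewrite /= /lebesgue_rV_step /pushforward.
set m := lebesgue_rV n.
have mB : measurable (@rV_cons R n @^-1` A).
  by rewrite -[X in measurable X]setTI; exact: measurable_rV_cons.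
pose sh (p : measurableTypeR R * 'rV[R]_n) : measurableTypeR R * 'rV[R]_n :=
  (p.1 + (rV_uncons c).1, p.2 + (rV_uncons c).2).
have msh : measurable_fun setT sh.
  apply/measurable_fun_pairP; split => /=.
    exact: measurable_funD.
  exact: measurable_rVD.
have -> : @rV_cons R n @^-1` ((fun x => x + c) @^-1` A) =
    sh @^-1` (@rV_cons R n @^-1` A).
  by apply/funext => p /=; rewrite -{1}(rV_unconsK c) rV_consD.
rewrite [RHS](@product_measure_unique _ _ _ _ _ _ _
  (pushforward_measure (lebesgue_measure \x m)%E msh)) //.
move=> B C mB' mC; rewrite /= /pushforward /=.
rewrite (_ : sh @^-1` _ = ((fun x => x + (rV_uncons c).1) @^-1` B) `*`
    ((fun x => x + (rV_uncons c).2) @^-1` C)); last first.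
  by apply/seteqP; split => -[x v].
rewrite product_measure1E//=; first by rewrite lebesgue_measure_translation// IHn.
  by rewrite -[X in measurable X]setTI; apply: measurable_funD.
by rewrite -[X in measurable X]setTI; apply: measurable_rVD.
Qed.

End lebesgue_rV_invariance.

(** * Change of variables and of measure in nonnegative integrals *)

Section integral_transfer.
Local Open Scope ereal_scope.
Context {disp : measure_display} {S : measurableType disp} {R : realType}.
Variable m : {measure set S -> \bar R}.

Lemma ge0_integral_invariant (phi : S -> S) (h : S -> \bar R) :
  measurable_fun setT phi ->
  (forall A, measurable A -> m (phi @^-1` A) = m A) ->
  measurable_fun setT h -> (forall x, 0 <= h x) ->
  \int[m]_x h (phi x) = \int[m]_x h x.
Proof.
move=> mphi inv mh h0; transitivity (\int[pushforward m phi]_x h x).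
  by rewrite ge0_integral_pushforward.
rewrite -[LHS]/(\int[pushforward_measure m mphi]_x h x).
by apply: eq_measure_integral => A mA _; exact: inv.
Qed.

Import HBNNSimple.

(** The hypothesis on [nu] is the case of indicators; linearity extends it to simple functions and
    monotone convergence to all [h]. *)
Lemma ge0_integral_density (nu : {measure set S -> \bar R}) (f : S -> R)
    (h : S -> \bar R) :
  measurable_fun setT f -> (forall x, 0 <= f x)%R ->
  (forall A, measurable A -> nu A = \int[m]_(x in A) (f x)%:E) ->
  measurable_fun setT h -> (forall x, 0 <= h x) ->
  \int[nu]_x h x = \int[m]_x (h x * (f x)%:E).
Proof.
move=> mf f0 nuE mh h0.
pose g := nnsfun_approx measurableT mh.
have mgf n : measurable_fun setT (fun x => (g n x)%:E * (f x)%:E).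
  by apply: emeasurable_funM; exact/measurable_EFinP.
have hE x : h x = limn (fun n => (g n x)%:E).
  by apply/esym/cvg_lim => //; exact: cvg_nnsfun_approx.
transitivity (limn (fun n => \int[nu]_x (g n x)%:E)).
  rewrite -monotone_convergence//.
  - by apply: eq_integral => x _; exact: hE.
  - by move=> n; exact/measurable_EFinP.
  - by move=> n x _; rewrite lee_fin.
  - by move=> x _ a b ab; rewrite lee_fin; exact/lefP/nd_nnsfun_approx.
transitivity (limn (fun n => \int[m]_x ((g n x)%:E * (f x)%:E))); last first.
  rewrite -monotone_convergence//.
  - apply: eq_integral => x _; apply/cvg_lim => //.
    by apply: cvgeZr => //; exact: cvg_nnsfun_approx.
  - by move=> n x _; apply: mule_ge0; rewrite lee_fin.
  - move=> x _ a b ab; rewrite lee_wpmul2r ?lee_fin ?f0//.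
    exact/lefP/nd_nnsfun_approx.
congr (limn _); apply/funext => n.
have indic0 r x : 0 <= (r * \1_(g n @^-1` [set r]) x)%:E.
  exact: nnfun_muleindic_ge0.
transitivity (\sum_(r \in range (g n)) \int[nu]_x (r * \1_(g n @^-1` [set r]) x)%:E).
  rewrite -ge0_integral_fsum//.
    by apply: eq_integral => x _; rewrite fimfunE -fsumEFin.
  by move=> r; apply/measurable_EFinP; exact: measurable_funM.
transitivity (\sum_(r \in range (g n))
    \int[m]_x ((r * \1_(g n @^-1` [set r]) x)%:E * (f x)%:E)); last first.
  rewrite -ge0_integral_fsum//.
  - apply: eq_integral => x _; rewrite -ge0_mule_fsuml// fsumEFin//.
    by rewrite -fimfunE.
  - move=> r; apply: emeasurable_funM; apply/measurable_EFinP => //.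
    exact: measurable_funM.
  - by move=> r x _; apply: mule_ge0; rewrite ?indic0// lee_fin.
apply: eq_fsbigr => r /[!inE] -[y _ <-].
under [RHS]eq_integral do rewrite EFinM -muleA.
under [LHS]eq_integral do rewrite EFinM.
rewrite !ge0_integralZl ?lee_fin//=.
- congr (_ * _); rewrite integral_indic// setIT nuE// integral_mkcond.
  by apply: eq_integral => x _; rewrite epatch_indic muleC.
- by apply: emeasurable_funM => //; exact/measurable_EFinP.
- by move=> x _; rewrite mule_ge0 ?lee_fin.
- exact/measurable_EFinP.
Qed.

End integral_transfer.

(** * Invariance of Lebesgue measure under linear reflections *)

Section lebesgue_rV_isometry.
Local Open Scope ereal_scope.
Context {R : realType} {d : nat}.
Implicit Types (x y c : 'rV[R]_d) (h : 'rV[R]_d -> \bar R).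
Local Notation lam := (@lebesgue_rV R d).

Lemma ge0_integral_translation c h : measurable_fun setT h -> (forall x, 0 <= h x) ->
  \int[lam]_x h (x + c)%R = \int[lam]_x h x.
Proof.
apply: (@ge0_integral_invariant _ _ _ lam (fun x => x + c)%R).
  exact: measurable_rVD.
exact: lebesgue_rV_translation.
Qed.

Lemma measurable_unit_ball : measurable [set x : 'rV[R]_d | (enorm x <= 1)%R].
Proof.
rewrite (_ : [set _ | _] = (@enorm R d) @^-1` `]-oo, 1%R]%classic).
  by apply: measurable_preimage => //; exact: measurable_enorm.
by apply/seteqP; split => x /=; rewrite in_itv.
Qed.

(** The ball lies between the cubes of half-side 1 / (d + 1) and 1. Both bounds are needed to cancel
    its measure as a common factor in [lebesgue_rV_isometry]. *)
Lemma lebesgue_rV_unit_ball : 0 < lam [set x | (enorm x <= 1)%R] < +oo.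
Proof.
pose box (e : R) := [set x : 'rV[R]_d | forall i, `[(- e)%R, e]%classic (x ord0 i)].
have mbox e : measurable (box e).
  rewrite (_ : box e = \bigcap_(i in [set: 'I_d])
      ((@coord_rV _ R d i) @^-1` `[(- e)%R, e]%classic)).
    apply: fin_bigcap_measurable => // i _.
    by apply: measurable_preimage => //; exact: measurable_coord_rV.
  by apply/seteqP; split => v /= h i => [_|]; exact: h.
have lbox e : (0 < e)%R -> 0 < lam (box e) < +oo.
  move=> e0; rewrite /box (lebesgue_rV_box (A := fun=> `[(- e)%R, e]%classic))//.
  rewrite lebesgue_measure_itv/= lte_fin gtrN// -EFinD.
  rewrite prodEFin ltry andbT lte_fin.
  by rewrite prodr_gt0// => i _; lra.
have mball := measurable_unit_ball.
apply/andP; split.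
  have e0 : (0 < d.+1%:R^-1 :> R)%R by rewrite invr_gt0.
  have /andP[h _] := lbox _ e0.
  apply: lt_le_trans h _; apply: le_measure; rewrite ?inE// => x /= hx.
  apply: enorm_le_coord => // i; rewrite div1r ler_norml.
  by have := hx i; rewrite /= in_itv.
have /andP[_ h] := lbox _ ltr01.
apply: le_lt_trans h; apply: le_measure; rewrite ?inE// => x /= hx i.
by rewrite /= in_itv /= -ler_norml (le_trans (coord_le_enorm _ _)).
Qed.

(* As in the proof of uniqueness of Haar measure: for B the unit ball, Fubini and
   translations give lam (L^-1 A) * lam B = lam A * lam B. *)
Lemma lebesgue_rV_isometry (L : 'rV[R]_d -> 'rV[R]_d) (A : set 'rV[R]_d) :
  measurable_fun setT L -> {morph L : x y / (x + y)%R} -> involutive L ->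
  (forall x, enorm (L x) = enorm x) -> measurable A ->
  lam (L @^-1` A) = lam A.
Proof.
move=> mL LD LK Ln mA; set B := [set x : 'rV[R]_d | (enorm x <= 1)%R].
have /andP[B0 Boo] := lebesgue_rV_unit_ball; rewrite -/B in B0 Boo.
have mB : measurable B by exact: measurable_unit_ball.
have Bfin : lam B \is a fin_num by rewrite ge0_fin_numE.
suff E : lam (L @^-1` A) * lam B = lam A * lam B.
  apply: le_anti; rewrite -[X in X && _](lee_pmul2r Bfin B0).
  by rewrite -[X in _ && X](lee_pmul2r Bfin B0) E lexx.
pose I (C : set 'rV[R]_d) x : \bar R := (\1_C x)%:E.
have mI d' (S : measurableType d') (p : S -> 'rV[R]_d) C : measurable C ->
    measurable_fun setT p -> measurable_fun setT (fun s => I C (p s)).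
  move=> mC mp; apply/measurable_EFinP.
  by apply: measurableT_comp => //; exact: measurable_indic.
have I0 C x : 0 <= I C x by rewrite lee_fin.
have intI C : measurable C -> \int[lam]_x I C x = lam C.
  by move=> mC; rewrite integral_indic// setIT.
have mLA := measurable_preimage mL mA.
have mp1 : measurable_fun setT (fun p : 'rV[R]_d * 'rV[R]_d => L p.1).
  exact: measurableT_comp.
have mp2 : measurable_fun setT (fun p : 'rV[R]_d * 'rV[R]_d => p.2 - L p.1)%R.
  exact: measurable_rVB.
have mp3 : measurable_fun setT (fun p : 'rV[R]_d * 'rV[R]_d => L p.1 + p.2)%R.
  exact: measurable_rVD.
have mp4 : measurable_fun setT (fun p : 'rV[R]_d * 'rV[R]_d => - L p.1)%R.
  exact: measurable_rVN.
transitivity (\int[lam]_x \int[lam]_y (I A (L x) * I B (y - L x)%R)).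
  rewrite -[in LHS](intI _ mLA) -ge0_integralZr//; last exact: (mI _ _ id).
  apply: eq_integral => x _; rewrite ge0_integralZl//; last first.
    by apply: mI => //; exact: measurable_rVB.
  by rewrite (ge0_integral_translation (- L x) (h := I B)) ?intI//; exact: (mI _ _ id).
rewrite (fubini_tonelli (m1 := lam) (m2 := lam)
  (fun p => I A (L p.1) * I B (p.2 - L p.1)%R)); last 2 first.
- by apply: emeasurable_funM; exact: mI.
- by move=> p; exact: mule_ge0.
transitivity (\int[lam]_y \int[lam]_x (I A (L x + y)%R * I B (- L x)%R)).
  apply: eq_integral => y _; rewrite /=.
  (* As [L] is additive and involutive, moving x by L y turns L x into L x + y. Thus y leaves the
     argument of [I B] and enters that of [I A], and the two factors separate after swapping the
     integrals back. *)
  rewrite -(ge0_integral_translation (L y)); last 2 first.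
  - apply: emeasurable_funM; apply: mI => //; exact: measurable_rVB.
  - by move=> x; exact: mule_ge0.
  by apply: eq_integral => x _; rewrite LD LK opprD addrCA subrr addr0.
rewrite -(fubini_tonelli (m1 := lam) (m2 := lam)
  (fun p => I A (L p.1 + p.2)%R * I B (- L p.1)%R)); last 2 first.
- by apply: emeasurable_funM; exact: mI.
- by move=> p; exact: mule_ge0.
rewrite -[in RHS](intI _ mB) -ge0_integralZl//; last exact: (mI _ _ id).
apply: eq_integral => x _; rewrite /= ge0_integralZr//; last first.
  by apply: mI => //; exact: measurable_rVD.
congr (_ * _).
  under eq_integral do rewrite addrC.
  by rewrite (ge0_integral_translation (L x) (h := I A)) ?intI//; exact: (mI _ _ id).
by rewrite /I !indicE (_ : (- L x \in B)%R = (x \in B))//;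
  apply/idP/idP; rewrite !inE /B /= enormN Ln.
Qed.

End lebesgue_rV_isometry.

(** * Radial monotonicity and its stability under convolution *)

Section radially_decreasing.
Local Open Scope ereal_scope.
Context {R : realType} {d : nat}.
Implicit Types (x y z w : 'rV[R]_d) (g : 'rV[R]_d -> \bar R) (f : 'rV[R]_d -> R).
Local Notation lam := (@lebesgue_rV R d).

(** The non-strict comparison of norms makes radial symmetry part of the notion. Values are extended
    reals because convolutions may be infinite. *)
Definition radially_decreasing g : Prop :=
  forall x y, (enorm x <= enorm y)%R -> g y <= g x.

Lemma radially_decreasing_eq g x y : radially_decreasing g ->
  enorm x = enorm y -> g x = g y.
Proof. by move=> rg xy; apply/eqP; rewrite eq_le !rg ?xy. Qed.

(** By symmetry x may be replaced by s y with s = |x| / |y| in [0, 1]. This point is the convex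
    combination of y and -y with weights (1 + s) / 2 and (1 - s) / 2, and phi takes the same value
    at both ends. *)
Lemma log_concave_radially_decreasing f :
  log_concave f -> radially_symmetric f -> radially_decreasing (EFin \o f).
Proof.
move=> [phi [phiNy cphi fE]] rf x y xy /=.
have [y0|y0] := eqVneq (enorm y) 0%R.
  rewrite (rf x y)//; apply/eqP; rewrite eq_le xy y0.
  exact: enorm_ge0.
have yp : (0 < enorm y)%R by rewrite lt_neqAle eq_sym y0 enorm_ge0.
pose s : R := (enorm x / enorm y)%R.
have s0 : (0 <= s)%R by rewrite divr_ge0 ?enorm_ge0.
have s1 : (s <= 1)%R by rewrite ler_pdivrMr// mul1r.
rewrite (rf x (s *: y)%R); last by rewrite enormZ ger0_norm// divfK.
have phiN : phi (- y)%R = phi y.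
  by apply: oppe_inj; apply: expeR_inj; rewrite -!fE (rf _ y)// enormN.
have := cphi y (- y)%R ((1 + s) / 2)%R.
rewrite phiN (_ : _ *: y + _ = s *: y)%R; last first.
  by rewrite scalerN -scalerBl; congr (_ *: _)%R; field.
move=> /(_ ltac:(lra)) h; rewrite !fE lee_expeR leeN2 (le_trans h)//.
have := phiNy y; case: (phi y) => [r _| _|//]; last by rewrite leey.
by rewrite -!EFinM -EFinD lee_fin -mulrDl addrCA subrr addr0 mul1r.
Qed.

Definition convolution g f z : \bar R := \int[lam]_w (g (z - w)%R * (f w)%:E).

(** The gap is (a - b)(p - q). Since a and b may be infinite, only p is split, as (p - q) + q, and
    the common terms b q + a q are cancelled. *)
Lemma rearrangement_two (p q : R) (a b : \bar R) :
  (0 <= q <= p)%R -> 0 <= b -> b <= a ->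
  b * p%:E + a * q%:E <= a * p%:E + b * q%:E.
Proof.
move=> /andP[q0 qp] b0 ba; have a0 := le_trans b0 ba.
have r0 : (0 <= p - q)%R by rewrite subr_ge0.
rewrite -[p](subrK q) EFinD !ge0_muleDr ?lee_fin//.
by rewrite -!addeA (addeC (b * q%:E)) leeD2r// lee_wpmul2r ?lee_fin.
Qed.

Section convolution.
Variables (g : 'rV[R]_d -> \bar R) (f : 'rV[R]_d -> R).
Hypotheses (mg : measurable_fun setT g) (g0 : forall x, 0 <= g x).
Hypotheses (mf : measurable_fun setT f) (f0 : forall x, (0 <= f x)%R).

Lemma convolution_ge0 z : 0 <= convolution g f z.
Proof. by apply: integral_ge0 => w _; rewrite mule_ge0 ?lee_fin. Qed.

Lemma measurable_convolution_integrand z :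
  measurable_fun setT (fun w => g (z - w)%R * (f w)%:E).
Proof.
apply: emeasurable_funM; last exact/measurable_EFinP.
by apply: measurableT_comp => //; exact: measurable_rVB.
Qed.

Lemma measurable_convolution : measurable_fun setT (convolution g f).
Proof.
have mF : measurable_fun setT (fun p : 'rV[R]_d * 'rV[R]_d =>
    g (p.1 - p.2)%R * (f p.2)%:E).
  apply: emeasurable_funM.
    by apply: measurableT_comp => //; exact: measurable_rVB.
  by apply/measurable_EFinP; exact: measurableT_comp.
have F0 p : 0 <= g (p.1 - p.2)%R * (f p.2)%:E by rewrite mule_ge0 ?lee_fin.
exact: (measurable_fun_fubini_tonelli_F _ mF F0).
Qed.

(* The affine reflection s exchanging z and z' brings w closer to the origin
   exactly when it exchanges the order of |z - w| and |z' - w|; averaging over w and s w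
   turns the claim into the two-point rearrangement inequality. *)
Lemma radially_decreasing_convolution :
  radially_decreasing g -> radially_decreasing (EFin \o f) ->
  radially_decreasing (convolution g f).
Proof.
move=> rg rf z z' zz'; have [->//|nzz'] := eqVneq z z'.
have [u uE] : exists u, u = (z - z')%R by exists (z - z')%R.
pose N := edot u u.
have N0 : (0 < N)%R by rewrite edot_gt0// uE subr_eq0.
have NE : (N = edot z z - 2 * edot z z' + edot z' z')%R.
  rewrite /N uE !(edotDl, edotDr, edotNl, edotNr) (edotC z' z); ring.
(* [rho] is the linear reflection in the hyperplane orthogonal to u, and [s] is [rho] followed by
   the translation that moves the mirror to the bisector of z and z'. Splitting them lets the linear
   invariance result apply to [rho]. *)
pose rho w := (w + (- (2 * edot w u / N)) *: u)%R.
pose k := (edot (z + z') u / N)%R.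
pose s w := (rho w + k *: u)%R.
pose t w := (k - 2 * edot w u / N)%R.
have sE w : s w = (w + t w *: u)%R.
  by rewrite /s /rho /t scalerBl scaleNr -addrA (addrC (- _)%R).
have tE w : (t w = (edot z z - edot z' z' - 2 * edot w z + 2 * edot w z') / N)%R.
  rewrite /t /k uE !(edotDl, edotDr, edotNl, edotNr) (edotC z' z); field.
  by rewrite gt_eqF.
have Nn0 : (edot z z - 2 * edot z z' + edot z' z' != 0)%R by rewrite -NE gt_eqF.
have zs w : enorm (z - s w)%R = enorm (z' - w)%R.
  rewrite !enormE; congr Num.sqrt; rewrite sE tE NE uE.
  rewrite !(edotDl, edotDr, edotNl, edotNr, edotZl, edotZr).
  rewrite (edotC z' z) (edotC z w) (edotC z' w); field.
  by [].
have z's w : enorm (z' - s w)%R = enorm (z - w)%R.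
  rewrite !enormE; congr Num.sqrt; rewrite sE tE NE uE.
  rewrite !(edotDl, edotDr, edotNl, edotNr, edotZl, edotZr).
  rewrite (edotC z' z) (edotC z w) (edotC z' w); field.
  by [].
(* Here |z| <= |z'|, so the sign of [t w] decides which of w and s w is nearer the origin; by [tN]
   the same sign decides which of z and z' is nearer w. *)
have ssE w : (edot (s w) (s w) = edot w w + t w * (edot z z - edot z' z'))%R.
  rewrite sE tE NE uE !(edotDl, edotDr, edotNl, edotNr, edotZl, edotZr).
  rewrite (edotC z' z) (edotC z w) (edotC z' w); field.
  by [].
have tN w : (t w * N = edot (z - w) (z - w) - edot (z' - w) (z' - w))%R.
  rewrite tE divfK ?gt_eqF// !(edotDl, edotDr, edotNl, edotNr).
  rewrite (edotC z w) (edotC z' w); ring.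
have mrho : measurable_fun setT rho.
  apply: measurable_rVD => //; apply: measurable_rVZ => //.
  apply: measurable_funN; apply: measurable_funM => //; apply: measurable_funM => //.
  apply: measurable_sum => i; apply: measurable_funM => //.
  exact: measurable_coord_rV.
have ms : measurable_fun setT s by exact: measurable_rVD.
have lrho (A : set 'rV[R]_d) : measurable A -> lam (rho @^-1` A) = lam A.
  apply: lebesgue_rV_isometry => //.
  - move=> x y; rewrite /rho edotDl mulrDr mulrDl opprD scalerDl.
    by rewrite addrACA.
  - move=> x; rewrite /rho edotDl edotZl -/N -addrA -scalerDl.
    have -> : (- (2 * edot x u / N) +
        - (2 * (edot x u + - (2 * edot x u / N) * N) / N) = 0)%R.
      by field; rewrite gt_eqF.
    by rewrite scale0r addr0.
  - move=> x; rewrite !enormE; congr Num.sqrt.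
    rewrite /rho !(edotDl, edotDr, edotZl, edotZr) -/N (edotC u x); field.
    by rewrite gt_eqF.
have int_s (h : 'rV[R]_d -> \bar R) : measurable_fun setT h -> (forall x, 0 <= h x) ->
    \int[lam]_w h (s w) = \int[lam]_w h w.
  move=> mh h0.
  rewrite (ge0_integral_invariant (m := lam) (phi := rho)
    (h := fun x => h (x + k *: u)%R))//.
    exact: ge0_integral_translation.
  by apply: measurableT_comp => //; exact: measurable_rVD.
have double y : convolution g f y + convolution g f y = \int[lam]_w
    (g (y - w)%R * (f w)%:E + g (y - s w)%R * (f (s w))%:E).
  rewrite ge0_integralD//.
  - congr (_ + _); rewrite (int_s (fun w => g (y - w)%R * (f w)%:E))//.
      exact: measurable_convolution_integrand.
    by move=> w; rewrite mule_ge0 ?lee_fin.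
  - by move=> w _; rewrite mule_ge0 ?lee_fin.
  - exact: measurable_convolution_integrand.
  - by move=> w _; rewrite mule_ge0 ?lee_fin.
  - apply: (measurableT_comp (measurable_convolution_integrand y)).
    exact: ms.
(* Halving is done by contradiction: a strict inequality would double to a strict one, even with
   infinite values. *)
suff D : convolution g f z' + convolution g f z' <= convolution g f z + convolution g f z.
  by rewrite leNgt; apply/negP => lt; move: D; rewrite leNgt lteD.
rewrite !double; apply: ge0_le_integral => //.
- by move=> w _; rewrite adde_ge0// mule_ge0 ?lee_fin.
- apply: emeasurable_funD; first exact: measurable_convolution_integrand.
  exact: (measurableT_comp (measurable_convolution_integrand z') ms).
- apply: emeasurable_funD; first exact: measurable_convolution_integrand.
  exact: (measurableT_comp (measurable_convolution_integrand z) ms).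
move=> w _; rewrite !(radially_decreasing_eq rg (zs w), radially_decreasing_eq rg (z's w)).
(* If t w <= 0, then z is at least as near w as z' is, and w at least as near the origin as s w, so
   g(z - w) pairs with f(w). Otherwise both orders are reversed. *)
have [tw|tw] := leP (t w) 0%R.
  apply: rearrangement_two => //.
    rewrite f0 -lee_fin; apply: rf; rewrite ler_enorm ssE lerDl.
    by rewrite mulr_le0// subr_le0 -ler_enorm.
  by apply: rg; rewrite ler_enorm -subr_le0 -tN mulr_le0_ge0// ltW.
rewrite addeC [leRHS]addeC; apply: rearrangement_two => //.
  rewrite f0 -lee_fin; apply: rf; rewrite ler_enorm ssE gerDl.
  by rewrite mulr_ge0_le0 ?(ltW tw)// subr_le0 -ler_enorm.
by apply: rg; rewrite ler_enorm -subr_ge0 -tN mulr_ge0// ltW.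
Qed.

End convolution.
End radially_decreasing.

(** * Law of a sum with an independent noise having a density *)

Section law_of_sum.
Local Open Scope ereal_scope.
Context {R : realType} {d : nat} {disp : measure_display}.
Context {Omega : measurableType disp} {P : probability Omega R}.
Implicit Types (h g : 'rV[R]_d -> \bar R).
Local Notation lam := (@lebesgue_rV R d).
Variables (Z W : {RV P >-> 'rV[R]_d}) (f : 'rV[R]_d -> R).
Hypothesis W_density : has_density (pushforward P W) f.
Hypothesis ZW_indep : independent_rv P Z W.

Let mf : measurable_fun setT f. Proof. by case: W_density. Qed.
Let f0 x : (0 <= f x)%R. Proof. by case: W_density. Qed.
Let mZ : measurable_fun setT Z. Proof. exact: measurable_funPT. Qed.
Let mW : measurable_fun setT W. Proof. exact: measurable_funPT. Qed.

(** Independence says that the joint law of (Z, W) agrees with the product law on rectangles, hence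
    everywhere; Tonelli and the density of W do the rest. *)
Lemma ge0_integral_law_sum h : measurable_fun setT h -> (forall x, 0 <= h x) ->
  \int[pushforward P (fun o => Z o + W o)%R]_x h x =
  \int[P]_o \int[lam]_w (h (Z o + w)%R * (f w)%:E).
Proof.
move=> mh h0.
have mY : measurable_fun setT (fun o => Z o + W o)%R by exact: measurable_rVD.
have mZW : measurable_fun setT (fun o => (Z o, W o)) by exact/measurable_fun_pairP.
pose H (p : 'rV[R]_d * 'rV[R]_d) := h (p.1 + p.2)%R.
have mH : measurable_fun setT H.
  by apply: measurableT_comp => //; exact: measurable_rVD.
have H0 p : 0 <= H p by exact: h0.
pose mu := distribution P Z; pose nu := distribution P W.
have nuE x : \int[nu]_w H (x, w) = \int[lam]_w (h (x + w)%R * (f w)%:E).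
  rewrite (ge0_integral_density (m := lam) mf f0)//.
    by case: W_density.
  by apply: measurableT_comp => //; exact: measurable_rVD.
rewrite ge0_integral_pushforward//=.
transitivity (\int[pushforward_measure P mZW]_p H p).
  by rewrite ge0_integral_pushforward.
transitivity (\int[(mu \x nu)]_p H p).
  apply: eq_measure_integral => A mA _; apply/esym.
  exact: product_measure_unique.
rewrite fubini_tonelli1// /fubini_F ge0_integral_pushforward//.
- by apply: eq_integral => o _ /=; rewrite nuE.
- exact: measurable_fun_fubini_tonelli_F.
- by move=> x _; exact: integral_ge0.
Qed.

Hypothesis f_even : forall x, f (- x)%R = f x.

(** Reconciles the z + w produced by a sum with the z - w of a convolution, through the isometry w
    -> -w. *)
Lemma convolution_evenE g z : measurable_fun setT g -> (forall x, 0 <= g x) ->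
  \int[lam]_w (g (z + w)%R * (f w)%:E) = convolution g f z.
Proof.
move=> mg g0.
rewrite /convolution -(ge0_integral_invariant (m := lam) (phi := @GRing.opp 'rV[R]_d)).
- by apply: eq_integral => w _; rewrite f_even.
- exact: measurable_rVN.
- move=> A mA; apply: lebesgue_rV_isometry => //.
  + exact: measurable_rVN.
  + exact: opprD.
  + exact: opprK.
  + exact: enormN.
- apply: emeasurable_funM; last exact/measurable_EFinP.
  by apply: measurableT_comp => //; exact: measurable_rVD.
- by move=> x; rewrite mule_ge0 ?lee_fin.
Qed.

Lemma measurable_avg_shift g : measurable_fun setT g -> (forall x, 0 <= g x) ->
  measurable_fun setT (fun y : 'rV[R]_d => \int[P]_o g (y - Z o)%R).
Proof.
move=> mg g0.
have mG : measurable_fun setT (fun p : 'rV[R]_d * Omega => g (p.1 - Z p.2)%R).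
  apply: measurableT_comp => //; apply: measurable_rVB => //.
  exact: measurableT_comp.
exact: (measurable_fun_fubini_tonelli_F (m2 := P) _ mG).
Qed.

(** The common source of both formulas. The inner average is the kernel average when g is the
    exponential kernel convolved with [f], and the density of Z + W when g is [f]. *)
Lemma integral_law_sum_avg_shift g : measurable_fun setT g -> (forall x, 0 <= g x) ->
  \int[pushforward P (fun o => Z o + W o)%R]_y \int[P]_o g (y - Z o)%R =
  \int[P]_o \int[P]_o' convolution g f (Z o - Z o')%R.
Proof.
move=> mg g0; rewrite ge0_integral_law_sum//; last 2 first.
- exact: measurable_avg_shift.
- by move=> x; exact: integral_ge0.
apply: eq_integral => o _.
have mG : measurable_fun setT (fun p : 'rV[R]_d * Omega =>
    g (Z o + p.1 - Z p.2)%R * (f p.1)%:E).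
  apply: emeasurable_funM; last first.
    by apply/measurable_EFinP; exact: measurableT_comp.
  apply: measurableT_comp => //; apply: measurable_rVB.
    exact: measurable_rVD.
  exact: measurableT_comp.
transitivity (\int[lam]_w \int[P]_o' (g (Z o + w - Z o')%R * (f w)%:E)).
  apply: eq_integral => w _; rewrite ge0_integralZr ?lee_fin//.
  by apply: measurableT_comp => //; exact: measurable_rVB.
rewrite (fubini_tonelli _ mG) /=; last by move=> p; rewrite mule_ge0 ?lee_fin.
apply: eq_integral => o' _; rewrite -convolution_evenE//.
by apply: eq_integral => w _; rewrite addrAC.
Qed.

End law_of_sum.

(** * Double expectations under a contraction, and bounds for expectations *)

Section contraction.
Local Open Scope ereal_scope.
Context {R : realType} {d : nat} {disp : measure_display}.
Context {Omega : measurableType disp} {P : probability Omega R}.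

Lemma ge0_integral_contraction (X Z : {RV P >-> 'rV[R]_d}) (g : 'rV[R]_d -> \bar R) :
  measurable_fun setT g -> (forall x, 0 <= g x) -> radially_decreasing g ->
  (forall o o', enorm (Z o - Z o') <= enorm (X o - X o'))%R ->
  \int[P]_o \int[P]_o' g (X o - X o')%R <= \int[P]_o \int[P]_o' g (Z o - Z o')%R.
Proof.
move=> mg g0 rg ZX.
have mG (Y : {RV P >-> 'rV[R]_d}) :
    measurable_fun setT (fun p : Omega * Omega => g (Y p.1 - Y p.2)%R).
  have mY : measurable_fun setT Y by exact: measurable_funPT.
  by apply: measurableT_comp => //; apply: measurable_rVB; exact: measurableT_comp.
have mGo (Y : {RV P >-> 'rV[R]_d}) o :
    measurable_fun setT (fun o' => g (Y o - Y o')%R).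
  have mY : measurable_fun setT Y by exact: measurable_funPT.
  by apply: measurableT_comp => //; exact: measurable_rVB.
apply: ge0_le_integral => //.
- by move=> o _; exact: integral_ge0.
- exact: (measurable_fun_fubini_tonelli_F (m2 := P) _ (mG X)).
- exact: (measurable_fun_fubini_tonelli_F (m2 := P) _ (mG Z)).
move=> o _; apply: ge0_le_integral => // o' _; exact: rg.
Qed.

(** A zero integral would force [h] to vanish almost everywhere, making the whole space, of mass 1,
    a null set. *)
Lemma probability_integral_gt0 (h : Omega -> \bar R) :
  measurable_fun setT h -> (forall x, 0 < h x) -> 0 < \int[P]_x h x.
Proof.
move=> mh h0; rewrite lt_neqAle integral_ge0 ?andbT; last by move=> x _; exact: ltW.
apply/negP => /eqP/esym h_eq0.
have [N [mN N0 TN]] : ae_eq P setT h (cst 0).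
  apply/ae_eq_integral_abs => //; rewrite -[RHS]h_eq0.
  by apply: eq_integral => x _; rewrite gee0_abs// ltW.
have : P setT <= P N.
  apply: le_measure; rewrite ?inE// => x _; apply: TN => /= /(_ I) hx.
  by have := h0 x; rewrite hx ltxx.
by rewrite N0 probability_setT lee_fin ler10.
Qed.

Lemma probability_integral_le1 (h : Omega -> \bar R) :
  measurable_fun setT h -> (forall x, 0 <= h x) -> (forall x, h x <= 1) ->
  \int[P]_x h x <= 1.
Proof.
move=> mh h0 h1; apply: (@le_trans _ _ (\int[P]_x cst 1 x)).
  exact: ge0_le_integral.
by rewrite integral_cst// mul1e; exact: probability_le1.
Qed.

End contraction.

(* Integrating each density against the measure given by the other avoids any
   appeal to their almost everywhere equality. *)
Lemma integral_density_sqr (disp : measure_display) (S : measurableType disp)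
    (R : realType) (m nu : {measure set S -> \bar R}) (f p : S -> R) :
  measurable_fun setT f -> (forall x, 0 <= f x) ->
  (forall A, measurable A -> nu A = (\int[m]_(x in A) (f x)%:E)%E) ->
  measurable_fun setT p -> (forall x, 0 <= p x) ->
  (forall A, measurable A -> nu A = (\int[m]_(x in A) (p x)%:E)%E) ->
  (\int[m]_x ((f x) ^+ 2)%:E = \int[nu]_x (p x)%:E)%E.
Proof.
move=> mf f0 fE mp p0 pE.
have mef : measurable_fun setT (EFin \o f) by exact/measurable_EFinP.
have mep : measurable_fun setT (EFin \o p) by exact/measurable_EFinP.
rewrite (ge0_integral_density mf f0 fE mep)//.
transitivity (\int[nu]_x (f x)%:E)%E.
  by rewrite (ge0_integral_density mf f0 fE mef).
rewrite (ge0_integral_density mp p0 pE mef)//.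
by apply: eq_integral => x _; rewrite /= muleC.
Qed.

(** * Diversity and entropy of Z + W as double expectations *)

Section diversity_and_entropy_of_sum.
Local Open Scope ereal_scope.
Context {R : realType} {d : nat} {disp : measure_display}.
Context {Omega : measurableType disp} {P : probability Omega R}.
Variables (Z W : {RV P >-> 'rV[R]_d}) (f : 'rV[R]_d -> R).
Hypothesis W_density : has_density (pushforward P W) f.
Hypothesis ZW_indep : independent_rv P Z W.
Hypothesis f_dec : radially_decreasing (EFin \o f).
Local Notation lam := (@lebesgue_rV R d).
Local Notation law := (pushforward P (fun o => Z o + W o)%R).

Let mf : measurable_fun setT f. Proof. by case: W_density. Qed.
Let f0 x : (0 <= f x)%R. Proof. by case: W_density. Qed.
Let mZ : measurable_fun setT Z. Proof. exact: measurable_funPT. Qed.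
Let mef : measurable_fun setT (EFin \o f). Proof. exact/measurable_EFinP. Qed.
Let ef0 x : 0 <= (EFin \o f) x. Proof. by rewrite lee_fin. Qed.

Let mY : measurable_fun setT (fun o => Z o + W o)%R.
Proof. by apply: measurable_rVD => //; exact: measurable_funPT. Qed.

Let f_even x : f (- x)%R = f x.
Proof. exact: EFin_inj (radially_decreasing_eq f_dec (enormN x)). Qed.

Definition exp_kernel (t : R) (v : 'rV[R]_d) : \bar R :=
  (expR (- (t * enorm v)))%:E.

Lemma exp_kernel_ge0 t v : 0 <= exp_kernel t v.
Proof. by rewrite lee_fin expR_ge0. Qed.

Lemma measurable_exp_kernel t : measurable_fun setT (exp_kernel t).
Proof.
apply/measurable_EFinP; apply: measurableT_comp => //.
apply: measurable_funN; apply: measurable_funM => //.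
exact: measurable_enorm.
Qed.

Lemma radially_decreasing_exp_kernel t : (0 <= t)%R ->
  radially_decreasing (exp_kernel t).
Proof. by move=> t0 x y xy; rewrite lee_fin ler_expR lerN2 ler_wpM2l. Qed.

Let measurable_exp_kernel_shift t (x : 'rV[R]_d) :
  measurable_fun setT (fun y : 'rV[R]_d => exp_kernel t (x - y)%R).
Proof.
apply: (measurableT_comp (measurable_exp_kernel t)).
exact: measurable_rVB.
Qed.

Lemma kernel_avg_sum t x :
  kernel_avg t law x = \int[P]_o convolution (exp_kernel t) f (x - Z o)%R.
Proof.
rewrite /kernel_avg -[LHS]/(\int[law]_y exp_kernel t (x - y)%R).
rewrite (ge0_integral_law_sum W_density ZW_indep (h := fun y => exp_kernel t (x - y)%R)).
- by apply: eq_integral => o _; apply: eq_integral => w _; rewrite opprD addrA.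
- exact: measurable_exp_kernel_shift.
- by move=> y; exact: exp_kernel_ge0.
Qed.

Lemma integral_kernel_avg_sum t : \int[law]_x kernel_avg t law x =
  \int[P]_o \int[P]_o' convolution (convolution (exp_kernel t) f) f (Z o - Z o')%R.
Proof.
under eq_integral do rewrite kernel_avg_sum.
apply: (integral_law_sum_avg_shift W_density ZW_indep f_even).
- apply: measurable_convolution => //; first exact: measurable_exp_kernel.
  exact: exp_kernel_ge0.
- by move=> x; apply: convolution_ge0 => //; exact: exp_kernel_ge0.
Qed.

(** Guards the [fine] and the inverse in [diversity2]: both +oo and 0 would be sent to 0 and break
    monotonicity. *)
Lemma integral_kernel_avg_sum_bounds t : (0 <= t)%R ->
  0 < \int[law]_x kernel_avg t law x <= 1.
Proof.
move=> t0; pose Y : {RV P >-> 'rV[R]_d} :=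
  HB.pack (fun o => Z o + W o)%R (isMeasurableFun.Build _ _ _ _ _ mY).
pose Q := distribution P Y.
have mk : measurable_fun setT (kernel_avg t law).
  rewrite (funext (kernel_avg_sum t)); apply: measurable_avg_shift.
    apply: measurable_convolution => //; first exact: measurable_exp_kernel.
    exact: exp_kernel_ge0.
  by move=> x; apply: convolution_ge0 => //; exact: exp_kernel_ge0.
have k0 x : 0 < kernel_avg t law x.
  apply: (@probability_integral_gt0 _ _ _ Q (fun y => exp_kernel t (x - y)%R)).
    exact: measurable_exp_kernel_shift.
  by move=> y; rewrite lte_fin expR_gt0.
have k1 x : kernel_avg t law x <= 1.
  apply: (@probability_integral_le1 _ _ _ Q (fun y => exp_kernel t (x - y)%R)) => [|y|y].
  - exact: measurable_exp_kernel_shift.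
  - exact: exp_kernel_ge0.
  - by rewrite lee_fin -expR0 ler_expR oppr_le0 mulr_ge0// enorm_ge0.
apply/andP; split; first exact: (@probability_integral_gt0 _ _ _ Q).
by apply: (@probability_integral_le1 _ _ _ Q) => // x; exact: ltW.
Qed.

(** [f] is bounded by [f 0], so the expectation is finite and [fine] loses nothing. *)
Definition sum_density (y : 'rV[R]_d) : R := fine (\int[P]_o (f (y - Z o))%:E).

Let f_le x : (f x <= f 0)%R.
Proof.
rewrite -lee_fin; apply: f_dec.
by rewrite (_ : enorm 0 = 0)%R ?enorm_ge0// -(scale0r 0%R) enormZ normr0 mul0r.
Qed.

Let mshift y : measurable_fun setT (fun o => f (y - Z o)%R).
Proof. by apply: measurableT_comp => //; exact: measurable_rVB. Qed.

Lemma sum_densityE y : (sum_density y)%:E = \int[P]_o (f (y - Z o))%:E.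
Proof.
rewrite fineK// ge0_fin_numE; last by apply: integral_ge0 => o _; rewrite lee_fin.
apply: (@le_lt_trans _ _ (\int[P]_o (f 0)%:E)); last first.
  rewrite integral_cst// lte_mul_pinfty ?lee_fin//.
  exact: le_lt_trans (probability_le1 _ _) (ltry 1).
apply: ge0_le_integral => //; last by move=> o _; rewrite lee_fin.
- by move=> o _; rewrite lee_fin.
- exact/measurable_EFinP.
Qed.

(** Translate w by Z under the expectation and swap the integrals. This also keeps [renyi2] away
    from its default value -oo. *)
Lemma has_density_sum : has_density law sum_density.
Proof.
have p0 x : (0 <= sum_density x)%R.
  by rewrite -lee_fin sum_densityE; apply: integral_ge0 => o _; rewrite lee_fin.
split => //.
  apply/measurable_EFinP.
  rewrite (_ : _ \o _ = fun y : 'rV[R]_d => \int[P]_o (f (y - Z o)%R)%:E).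
    exact: (measurable_avg_shift Z mef ef0).
  by apply/funext => y; exact: sum_densityE.
move=> A mA.
have mI : measurable_fun setT (fun x : 'rV[R]_d => (\1_A x : R)%:E).
  by apply/measurable_EFinP; exact: measurable_indic.
have mIf o : measurable_fun setT (fun w => (\1_A (Z o + w)%R : R)%:E * (f w)%:E).
  apply: emeasurable_funM => //.
  by apply: (measurableT_comp mI); exact: measurable_rVD.
have mG : measurable_fun setT (fun p : Omega * 'rV[R]_d =>
    (\1_A p.2 : R)%:E * (f (p.2 - Z p.1)%R)%:E).
  apply: emeasurable_funM.
    exact: (measurableT_comp mI).
  apply/measurable_EFinP; apply: measurableT_comp => //.
  by apply: measurable_rVB => //; exact: measurableT_comp.
transitivity (\int[law]_x (\1_A x : R)%:E).
  rewrite -[RHS]/(\int[pushforward_measure P mY]_x (\1_A x : R)%:E).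
  by rewrite integral_indic// setIT.
rewrite (ge0_integral_law_sum W_density ZW_indep)//.
transitivity (\int[P]_o \int[lam]_y ((\1_A y : R)%:E * (f (y - Z o)%R)%:E)).
  apply: eq_integral => o _.
  rewrite -[RHS](ge0_integral_translation (Z o)).
  - by apply: eq_integral => w _; rewrite addrK addrC.
  - apply: emeasurable_funM => //; apply/measurable_EFinP.
    by apply: measurableT_comp => //; exact: measurable_rVB.
  - by move=> x; rewrite mule_ge0 ?lee_fin.
rewrite (fubini_tonelli _ mG) /=; last by move=> p; rewrite mule_ge0 ?lee_fin.
rewrite [RHS]integral_mkcond; apply: eq_integral => y _.
rewrite ge0_integralZl ?lee_fin//; last 2 first.
- exact/measurable_EFinP.
- by move=> o _; rewrite lee_fin.
by rewrite -sum_densityE epatch_indic muleC.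
Qed.

Lemma renyi2_sum : renyi2 law =
  - lne (\int[P]_o \int[P]_o' convolution (EFin \o f) f (Z o - Z o')%R).
Proof.
rewrite -(integral_law_sum_avg_shift W_density ZW_indep f_even)//.
have [mp p0 pE] := has_density_sum.
(* [renyi2] selects an unspecified density, so the integral of the square is computed for every
   density g of the law. *)
have densE g : has_density law g ->
    \int[lam]_x ((g x) ^+ 2)%:E = \int[law]_y \int[P]_o (EFin \o f) (y - Z o)%R.
  move=> [mg g0 gE].
  rewrite (@integral_density_sqr _ _ _ lam (pushforward_measure P mY) g sum_density)//.
  by apply: eq_integral => y _; exact: sum_densityE.
rewrite /renyi2; case: xgetP => [y -> [g /densE <-]//|].
by move=> /(_ _ (ex_intro2 _ _ _ has_density_sum erefl)).
Qed.

End diversity_and_entropy_of_sum.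

Lemma ler_inv_fine (R : realType) (a b : \bar R) : (0 < a)%E -> (a <= b)%E ->
  (b < +oo)%E -> (fine b)^-1 <= (fine a)^-1.
Proof.
move: a b => [a||] [b||] //=; rewrite ?lte_fin ?lee_fin // => a0 ab _.
by rewrite lef_pV2 ?posrE// (lt_le_trans a0).
Qed.

Unset Implicit Arguments.
Set Strict Implicit.
Set Printing Implicit Defensive.

Theorem theorem4p2 (R : realType) (d : nat)
    (disp : measure_display) (Omega : measurableType disp)
    (P : probability Omega R) (X W : {RV P >-> 'rV[R]_d})
    (f : 'rV[R]_d -> R)
    (W_density : has_density (pushforward P W) f)
    (f_log_concave : log_concave f)
    (f_radial : radially_symmetric f)
    (XW_indep : independent_rv P X W)
    (T : 'rV[R]_d -> 'rV[R]_d) (T_contraction : euclidean_contraction T) :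
  (forall t : R, 0 < t ->
    diversity2 t (pushforward P (fun w => T (X w) + W w)) <=
    diversity2 t (pushforward P (fun w => X w + W w))) /\
  (renyi2 (pushforward P (fun w => T (X w) + W w)%R) <=
   renyi2 (pushforward P (fun w => X w + W w)%R))%E.
Proof.
have mT := measurable_euclidean_contraction T_contraction.
have mTX : measurable_fun setT (fun o => T (X o)).
  by apply: measurableT_comp => //; exact: measurable_funPT.
pose TX : {RV P >-> 'rV[R]_d} :=
  HB.pack (fun o => T (X o)) (isMeasurableFun.Build _ _ _ _ _ mTX).
have TXW_indep : independent_rv P TX W.
  by move=> A B mA mB; exact: (XW_indep _ _ (measurable_preimage mT mA) mB).
have f_dec := log_concave_radially_decreasing f_log_concave f_radial.
have [mf f0 _] := W_density.
have TX_le o o' : enorm (TX o - TX o') <= enorm (X o - X o') by exact: T_contraction.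
split => [t /ltW t0|].
  pose k : 'rV[R]_d -> \bar R := exp_kernel t.
  have mk : measurable_fun setT k by exact: measurable_exp_kernel.
  have k0 x : (0 <= k x)%E by exact: exp_kernel_ge0.
  have c0 x : (0 <= convolution k f x)%E by exact: convolution_ge0.
  have mc : measurable_fun setT (convolution k f) by exact: measurable_convolution.
  have c_dec : radially_decreasing (convolution k f).
    apply: radially_decreasing_convolution => //.
    exact: radially_decreasing_exp_kernel.
  (* Positivity for X and the upper bound for T(X) suffice, since [IJ] orders the two integrals. *)
  have /andP[I0 _] := integral_kernel_avg_sum_bounds W_density XW_indep t0.
  have /andP[_ J1] := integral_kernel_avg_sum_bounds W_density TXW_indep t0.
  have IJ : (\int[pushforward P (fun o => X o + W o)%R]_x
        kernel_avg t (pushforward P (fun o => X o + W o)%R) x <=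
      \int[pushforward P (fun o => TX o + W o)%R]_x
        kernel_avg t (pushforward P (fun o => TX o + W o)%R) x)%E.
    rewrite (integral_kernel_avg_sum W_density XW_indep f_dec).
    rewrite (integral_kernel_avg_sum W_density TXW_indep f_dec).
    apply: (ge0_integral_contraction _ _ _ TX_le).
    - exact: measurable_convolution.
    - by move=> x; exact: convolution_ge0.
    - exact: radially_decreasing_convolution.
  exact: ler_inv_fine I0 IJ (le_lt_trans J1 (ltry 1)).
rewrite (renyi2_sum W_density TXW_indep f_dec) (renyi2_sum W_density XW_indep f_dec).
(* [lne] is monotone on all of [0, +oo], endpoints included, so infinite or zero integrals need no
   separate case. *)
have int0 (Z : {RV P >-> 'rV[R]_d}) :
    (\int[P]_o \int[P]_o' convolution (EFin \o f) f (Z o - Z o')%R)%E \in `[0%E, +oo%E].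
  rewrite in_itv /= leey andbT.
  apply: integral_ge0 => o _; apply: integral_ge0 => o' _.
  by apply: convolution_ge0 => // x; rewrite lee_fin.
have mef : measurable_fun setT (EFin \o f) by exact/measurable_EFinP.
have ef0 x : (0 <= (EFin \o f) x)%E by rewrite lee_fin.
rewrite leeN2 (lee_lne (int0 X) (int0 TX)).
apply: (ge0_integral_contraction _ _ _ TX_le).
- exact: measurable_convolution.
- by move=> x; exact: convolution_ge0.
- exact: radially_decreasing_convolution.
Qed.
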